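(* For every infinite $A\subseteq\mathbb{N}^{<\omega}$, the following are equivalent: (i) $I_{wf}\upharpoonright A$ belongs to $\mathcal{B}$. (ii) $I_{wf}\upharpoonright A$ is Borel. (iii) $I_{wf}\not\hookrightarrow I_{wf}\upharpoonright A$.
   Context: An ideal over a countable set $X$ is a family of subsets of $X$ that contains every finite subset of $X$ and is closed under taking subsets and finite unions ($\mathcal{P}(X)$ is allowed). Subsets are identified with characteristic functions, so an ideal is a subset of $2^X$, and ''Borel'' refers to this subset. For ideals $I$ on $X$ and $J$ on $Y$: $I\cong J$ (isomorphic) if there is a bijection $f:X\to Y$ such that $E\in I$ iff $f[E]\in J$; $I\hookrightarrow J$ if there is an injection $f:X\to Y$ such that, for $E\subseteq X$, $E\in I$ iff $f[E]\in J$. $I\upharpoonright K$ is the ideal on $K$ of all subsets of $K$ belonging to $I$. The orthogonal of $I$ is $I^\perp=\{B\subseteq X: A\cap B\text{ is finite for all }A\in I\}$. Direct sum: given finitely or countably many ideals $I_n$ on countably infinite sets $X_n$, take a partition $\{K_n\}$ of $\mathbb{N}$ and an isomorphic copy $I_n'$ of $I_n$ on $K_n$; then $A\in\bigoplus_n I_n$ iff $A\cap K_n\in I_n'$ for all $n$ (well defined up to isomorphism). $\mathcal{B}$ is the smallest collection of ideals on $\mathbb{N}$ containing the ideal of finite sets and closed under countable (including finite) direct sums and orthogonal; an ideal over a countable set is said to belong to $\mathcal{B}$ if it is isomorphic to an ideal in $\mathcal{B}$. $\mathbb{N}^{<\omega}$ is the set of finite sequences of natural numbers ordered by extension $\preceq$;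 a tree is a $\preceq$-downward closed subset, well founded if it has no infinite branch; $I_{wf}$ is the ideal on $\mathbb{N}^{<\omega}$ of sets contained in a well founded tree. *)

(* Defs.v *)
From mathcomp Require Import all_boot all_order.
From mathcomp Require Import all_classical all_analysis.

Set Implicit Arguments.
Unset Strict Implicit.
Unset Printing Implicit Defensive.

Local Open Scope classical_set_scope.

(* A family of subsets of a type [X] is a term of [set (set X)].  For a subset
   [K : set X], families on [K] live on the subtype [set_type K] (to which [K]
   coerces), and [set_val] is the inclusion of [K] in [X]. *)

Definition is_ideal (X : Type) (I : set (set X)) : Prop :=
  [/\ forall E, finite_set E -> I E,
      forall E F, E `<=` F -> I F -> I E
    & forall E F, I E -> I F -> I (E `|` F)].

Definition isomorphic (X Y : Type) (I : set (set X)) (J : set (set Y)) : Prop :=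
  exists2 f : X -> Y, bijective f & forall E, I E <-> J (f @` E).

Definition embeds (X Y : Type) (I : set (set X)) (J : set (set Y)) : Prop :=
  exists2 f : X -> Y, injective f & forall E, I E <-> J (f @` E).

Definition irestrict (X : Type) (I : set (set X)) (K : set X) : set (set K) :=
  [set E : set K | I (set_val @` E)].
Arguments irestrict {X} I K _.

Definition iorth (X : Type) (I : set (set X)) : set (set X) :=
  [set B | forall A, I A -> finite_set (A `&` B)].
Arguments iorth {X} I _.

(* [bool] carries the discrete topology and [{ptws X -> bool}] the product
   topology, so this is the Borel sigma-algebra of 2^X. *)
Definition is_borel (X : Type) (I : set (set X)) : Prop :=
  <<s [set U : set {ptws X -> bool} | open U] >>
    [set c : {ptws X -> bool} | I [set x | c x]].

(* The direct sum is only defined up to the choice of the partition and of the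
   copies of the summands, hence a relation.  [D] is the index set, so both
   finite and countably infinite sums are covered; the values of [X], [I] and
   [K] outside [D] are irrelevant.  [set_val @^-1` E] is [E `&` K n], seen as
   a subset of [K n]. *)
Definition is_direct_sum (D : set nat) (X : nat -> Type)
    (I : forall n, set (set (X n))) (S : set (set nat)) : Prop :=
  exists (K : nat -> set nat) (I' : forall n, set (set (K n))),
    [/\ partition D K setT,
        forall n, D n -> isomorphic (I n) (I' n)
      & S = [set E | forall n, D n -> I' n (set_val @^-1` E)]].

Definition sum_orth_closed (M : set (set (set nat))) : Prop :=
  [/\ forall I, M I -> is_ideal I,
      forall I, M I -> M (iorth I)
    & forall (D : set nat) (I : nat -> set (set nat)) (S : set (set nat)),
        (forall n, D n -> M (I n)) -> is_direct_sum D I S -> M S].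

Definition classB : set (set (set nat)) :=
  smallest sum_orth_closed [set finite_set].

Definition belongs_to_B (X : Type) (I : set (set X)) : Prop :=
  exists2 J, classB J & isomorphic I J.

Definition is_tree (T : set (seq nat)) : Prop :=
  forall s t, prefix s t -> T t -> T s.

Definition well_founded_tree (T : set (seq nat)) : Prop :=
  is_tree T /\ ~ exists x : nat -> nat, forall n, T (mkseq x n).

Definition I_wf : set (set (seq nat)) :=
  [set E | exists2 T, well_founded_tree T & E `<=` T].

(* Main.v *)
Require Import Defs.
From mathcomp Require Import all_boot all_order.
From mathcomp Require Import all_classical all_analysis.

(** A set lies in [I_wf] iff it has no cluster point in the Baire space. If
    [I_wf] embeds into its restriction to [A], the latter is not Borel, because
    [I_wf] is not. Conversely call a node bad if the restriction of [I_wf] to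
    [A] intersected with the cone of some node above it is not in B. If every
    node above [t] has finitely many bad children, Koenig's lemma exhibits
    [I_wf] on the cone of [t] as the orthogonal of a direct sum of orthogonals
    of ideals in B. Hence if the root is bad, then above every bad node there is
    a node with infinitely many bad children, and the full tree of finite
    sequences, with its ideal, can be copied inside the bad nodes. Finally,
    members of B are Borel since the class of Borel ideals [J] that have a Borel
    orthogonal and satisfy [J^oo = J] is closed under the two operations. *)

Set Implicit Arguments.
Unset Strict Implicit.
Unset Printing Implicit Defensive.

Local Open Scope classical_set_scope.

(** * Borel families of sets *)

Section GeneratedSigmaAlgebra.
Variables (T : Type) (G : set (set T)).

Lemma sigma_not (P : set T) : <<s G >> P -> <<s G >> (~` P).
Proof. by move=> mP; rewrite -setTD; exact: sigma_algebraCD. Qed.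

Lemma sigma_exists (I : countType) (P : I -> set T) :
  (forall i, <<s G >> (P i)) -> <<s G >> [set x | exists i, P i x].
Proof.
move=> mP.
have -> : [set x | exists i, P i x] =
    \bigcup_n (if unpickle n is Some i then P i else set0).
  apply/seteqP; split=> x /=; last by case=> n _; case: unpickle => [i|//]; exists i.
  by case=> i Pix; exists (pickle i) => //; rewrite pickleK.
apply: sigma_algebra_bigcup => n; case: unpickle => [i|]; first exact: mP.
exact: sigma_algebra0.
Qed.

Lemma sigma_forall (I : countType) (P : I -> set T) :
  (forall i, <<s G >> (P i)) -> <<s G >> [set x | forall i, P i x].
Proof.
move=> mP; rewrite -[X in <<s G >> X]setCK; apply: sigma_not.
have -> : ~` [set x | forall i, P i x] = [set x | exists i, (~` P i) x].
  by apply/seteqP; split=> x /= /existsNP.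
by apply: sigma_exists => i; exact: sigma_not.
Qed.

Lemma sigma_cst (Q : Prop) : <<s G >> [set _ | Q].
Proof.
have m0 := @sigma_algebra0 T setT G.
have [q|nq] := pselect Q.
  rewrite (_ : [set _ | Q] = ~` set0); first exact: sigma_not.
  by rewrite setC0; apply/seteqP; split.
by rewrite (_ : [set _ | Q] = set0) //; apply/seteqP; split=> x //=.
Qed.

Lemma sigma_and (P Q : set T) :
  <<s G >> P -> <<s G >> Q -> <<s G >> [set x | P x /\ Q x].
Proof.
move=> mP mQ.
have -> : [set x | P x /\ Q x] = [set x | forall b : bool, (if b then P else Q) x].
  apply/seteqP; split=> x /= => [[Px Qx] []//|PQ].
  by split; [exact: (PQ true)|exact: (PQ false)].
by apply: sigma_forall => -[].
Qed.

Lemma sigma_imply (Q : Prop) (P : set T) :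
  (Q -> <<s G >> P) -> <<s G >> [set x | Q -> P x].
Proof.
have [q /(_ q) mP|nq _] := pselect Q.
  by rewrite (_ : [set _ | _ -> _] = P) //; apply/seteqP; split=> x /=; [exact|].
rewrite (_ : [set _ | _ -> _] = [set _ | True]); first exact: sigma_cst.
by apply/seteqP; split=> x //=.
Qed.

Lemma sigma_iff (P : set T) (Q : Prop) :
  <<s G >> P -> <<s G >> [set x | P x <-> Q].
Proof.
move=> mP; have [q|nq] := pselect Q.
  rewrite (_ : [set _ | _] = P) //; apply/seteqP.
  by split=> x /=; [case=> _; apply|split].
rewrite (_ : [set _ | _] = ~` P); first exact: sigma_not.
by apply/seteqP; split=> x /=; [case=> + _ Px => /(_ Px)|split].
Qed.

End GeneratedSigmaAlgebra.

(** The sets with measurable preimage form a sigma-algebra containing [G]. *)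
Lemma sigma_preimage (T U : Type) (G : set (set T)) (H : set (set U)) (f : U -> T) :
  (forall A, G A -> <<s H >> (f @^-1` A)) ->
  forall A, <<s G >> A -> <<s H >> (f @^-1` A).
Proof.
move=> GH A GA; apply: (GA [set B | <<s H >> (f @^-1` B)]); split => //; split.
- by rewrite /= preimage_set0; exact: sigma_algebra0.
- by move=> B /= mB; rewrite setTD preimage_setC; exact: sigma_not.
- by move=> F /= mF; rewrite preimage_bigcup; exact: sigma_algebra_bigcup.
Qed.

(** Subbasic clopen sets of 2^X, written with subsets instead of characteristic functions; for
    countable [X] they generate the Borel sets, see [is_borelP]. *)
Definition coordinate_sets (X : Type) : set (set (set X)) :=
  [set U | exists x, U = [set E : set X | E x]].
Arguments coordinate_sets : clear implicits.

Notation borel_family := <<s coordinate_sets _ >>.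

Lemma borel_family_mem (X : Type) (x : X) : borel_family [set E : set X | E x].
Proof. by apply: sub_sigma_algebra; exists x. Qed.

Lemma borel_family_preimage (X Y : Type) (f : set X -> set Y) (F : set (set Y)) :
  (forall y, borel_family [set E | f E y]) ->
  borel_family F -> borel_family [set E | F (f E)].
Proof. by move=> mf; apply: sigma_preimage => _ [y ->]; exact: mf. Qed.

(** Otherwise points outside [U] agreeing with [c] on more and more coordinates would converge to
    [c]. *)
Lemma open_ptws_determined (X : countType) (U : set {ptws X -> bool})
    (c : {ptws X -> bool}) :
  open U -> U c -> exists n, forall d : {ptws X -> bool},
    (forall x : X, pickle x < n -> d x = c x) -> U d.
Proof.
move=> oU Uc; apply: contrapT => /forallNP H.
have {}H n : exists d : {ptws X -> bool},
    (forall x : X, pickle x < n -> d x = c x) /\ ~ U d.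
  by have /existsNP[d /not_implyP[dc Ud]] := H n; exists d.
move: H => /choice[u Hu].
have uc : u @ \oo --> c.
  apply/cvg_sup => x V [W [[B _ <-] Bcx BV]].
  apply: (filterS BV); rewrite nbhs_simpl; exists (pickle x).+1 => // n /= xn.
  by rewrite /proj /= (Hu n).1.
have /uc [n _ /(_ n (leqnn n))] : nbhs c U by rewrite nbhsE; exists U.
exact: (Hu n).2.
Qed.

Lemma is_borelP (X : countType) (I : set (set X)) : is_borel I <-> borel_family I.
Proof.
split=> [bI|].
  have -> : I = (fun E : set X => (fun x => `[< E x >]) : {ptws X -> bool}) @^-1`
      [set c : {ptws X -> bool} | I [set x | c x]].
    by apply/seteqP; split=> E /=; rewrite (_ : [set x | `[< E x >]] = E) //;
      apply/seteqP; split=> x /= /asboolP.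
  apply: sigma_preimage bI => U /= oU.
  (* An open set is the countable union of the basic cylinders inside it; [p] gives the number of
     coordinates and their values. *)
  have -> : (fun E : set X => (fun x => `[< E x >]) : {ptws X -> bool}) @^-1` U =
    [set E | exists p : nat * seq bool,
        (forall d : {ptws X -> bool},
          (forall x : X, pickle x < p.1 -> d x = nth false p.2 (pickle x)) -> U d)
        /\ forall x : X, pickle x < p.1 -> E x <-> nth false p.2 (pickle x)].
    apply/seteqP; split=> E /=.
      move=> /(open_ptws_determined oU)[n Hn].
      exists (n, mkseq (fun i => if unpickle i is Some x then `[< E x >] else false) n).
      by split=> [d dE|x xn /=]; [apply: Hn => x xn; rewrite dE//= | ];
        rewrite nth_mkseq// pickleK//; split=> /asboolP.
    move=> [p [pU pE]]; apply: pU => x xp.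
    by apply/idP/idP => [/asboolP /pE|/pE /asboolP]; apply.
  apply: sigma_exists => p; apply: sigma_and; first exact: sigma_cst.
  apply: sigma_forall => x; apply: sigma_imply => _.
  by apply: sigma_iff; exact: borel_family_mem.
apply: (@sigma_preimage _ {ptws X -> bool} _ _ (fun c => [set x | c x])).
move=> _ [x ->] /=.
apply: sub_sigma_algebra => /=.
rewrite (_ : _ @^-1` _ = (fun c : {ptws X -> bool} => c x) @^-1` [set true]);
  last by [].
apply: open_comp; last exact: discrete_open.
by move=> c _; exact: (@proj_continuous X (fun _ => bool) x c).
Qed.

(** * Analytic families, and the complexity of the well founded ideal *)

(** Equivalently, [x] is a branch of the tree of initial segments of elements of [E], the smallest
    tree containing [E]. *)
Definition clusters_at (E : set (seq nat)) (x : nat -> nat) :=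
  forall n, exists2 u, E u & prefix (mkseq x n) u.

Lemma I_wfP E : I_wf E <-> ~ exists x, clusters_at E x.
Proof.
split=> [[T [treeT wfT] ET] [x Ex]|noacc].
  apply: wfT; exists x => n; have [u Eu pu] := Ex n.
  exact: (treeT _ _ pu (ET _ Eu)).
exists [set s | exists2 u, E u & prefix s u]; last first.
  by move=> u Eu; exists u; last exact: prefix_refl.
split; last by case=> x Tx; apply: noacc; exists x.
by move=> s t st [u Eu tu]; exists u => //; exact: prefix_trans tu.
Qed.

Lemma take_mkseq (T : Type) (x : nat -> T) i n :
  i <= n -> take i (mkseq x n) = mkseq x i.
Proof. by move=> ilen; rewrite /mkseq -map_take take_iota (minn_idPl ilen). Qed.

Definition restr (x : set nat) (n : nat) : seq bool :=
  mkseq (fun i => `[< x i >]) n.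

(** The projection of a closed subset of the product of 2^N and the Baire space, closed sets being
    given by conditions on finite initial segments. *)
Definition analytic (S : set (set nat)) := exists P : seq bool -> seq nat -> Prop,
  forall x, S x <-> exists y : nat -> nat, forall n, P (restr x n) (mkseq y n).

(** The first entry of the witness guesses [k], the others witness [S k]; truncating [s] makes up
    for the shift by one. *)
Lemma analytic_exists (S : nat -> set (set nat)) :
  (forall k, analytic (S k)) -> analytic [set x | exists k, S k x].
Proof.
move=> /choice[P PS].
exists (fun s t => if t is k :: t' then P k (take (size t') s) t' else True) => x.
have E (y : nat -> nat) n : (mkseq y n.+1 = y 0 :: mkseq (y \o succn) n).
  by rewrite /mkseq /= -[1]/(1 + 0) iotaDl -map_comp.
split=> [[k /PS[y Py]]|[y Py]].
  exists (fun n => if n is m.+1 then y m else k) => -[//|n].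
  by rewrite E size_mkseq take_mkseq//; exact: Py.
exists (y 0); apply/PS; exists (y \o succn) => n.
move: (Py n.+1); rewrite (E y n). by rewrite size_mkseq take_mkseq.
Qed.

(** One sequence codes a witness for each [k]; a finite segment is tested against all instances of
    [P] that it already determines. *)
Lemma analytic_forall (S : nat -> set (set nat)) :
  (forall k, analytic (S k)) -> analytic [set x | forall k, S k x].
Proof.
move=> /choice[P PS].
exists (fun s t => forall k n, n <= size s ->
  (forall i, i < n -> pickle (k, i) < size t) ->
  P k (take n s) (mkseq (fun i => nth 0 t (pickle (k, i))) n)) => x.
have E (y : nat -> nat) N k n : (forall i, i < n -> pickle (k, i) < N) ->
    mkseq (fun i => nth 0 (mkseq y N) (pickle (k, i))) n =
    mkseq (fun i => y (pickle (k, i))) n.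
  move=> lt; apply/eq_in_map => i; rewrite mem_iota add0n => /= /lt.
  exact: nth_mkseq.
split=> [Sx|[y Py] k].
  have /choice[y Py] k := (PS k x).1 (Sx k).
  pose z j := if unpickle j is Some (k, i) then y k i else 0.
  exists z => N k n; rewrite !size_mkseq => nN lt; rewrite E// take_mkseq//.
  rewrite (_ : mkseq _ n = mkseq (y k) n :> seq nat); first exact: Py.
  by apply: eq_map => i; rewrite /z pickleK.
apply/PS; exists (fun i => y (pickle (k, i))) => n.
pose N := n + \max_(i < n) (pickle (k, nat_of_ord i)).+1.
have lt i : i < n -> pickle (k, i) < N.
  move=> lt_in; rewrite /N (leq_trans _ (leq_addl _ _))//.
  exact: (leq_bigmax (Ordinal lt_in)).
have := Py N k n; rewrite !size_mkseq E// take_mkseq ?leq_addr//.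
by apply; rewrite ?leq_addr.
Qed.

Lemma analytic_clopen (k : nat) (Q : bool -> Prop) :
  analytic [set x | Q `[< x k >]].
Proof.
exists (fun s _ => k < size s -> Q (nth false s k)) => x; split=> [Qx|[y /(_ k.+1)]].
  by exists (fun=> 0) => n; rewrite size_mkseq => kn; rewrite nth_mkseq.
by rewrite size_mkseq nth_mkseq//; apply.
Qed.

(** The sets that are analytic together with their complement form a sigma-algebra. *)
Lemma analytic_borel (S : set (set nat)) : borel_family S -> analytic S.
Proof.
move=> bS; suff [] : [set F | analytic F /\ analytic (~` F)] S by [].
apply: bS; split; last first.
  move=> _ [k ->]; split.
    rewrite (_ : mkset _ = [set x | is_true `[< x k >]]); first exact: analytic_clopen.
    by apply/seteqP; split=> x /= /asboolP.
  rewrite (_ : ~` _ = [set x | ~ is_true `[< x k >]]).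
    exact: (analytic_clopen k (fun b => ~ b)).
  by apply/seteqP; split=> x /= + /asboolP.
split.
- by split; [exact: (analytic_clopen 0 (fun=> False))
            |rewrite setC0; exact: (analytic_clopen 0 (fun=> True))].
- by move=> F []; rewrite setTD /= setCK.
move=> F /all_and2 [aF aF']; split.
  rewrite (_ : \bigcup_k _ = [set x | exists k, F k x]); first exact: analytic_exists.
  by apply/seteqP; split=> x; [case=> k _|case=> k]; exists k.
rewrite setC_bigcup (_ : \bigcap_(k in _) _ = [set x | forall k, (~` F k) x]).
  exact: analytic_forall.
by apply/seteqP; split=> x Fx k //; exact: Fx.
Qed.

(* Cantor's diagonal: each subset [x] of [nat] codes a relation between finite
   sequences, hence an analytic set; [x] lies outside the set it codes iff the
   tree of partial witnesses is well founded, so if [I_wf] were Borel the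
   complement of the diagonal would be Borel, hence analytic. *)
Lemma I_wf_not_borel : ~ borel_family I_wf.
Proof.
(* The infinite branches of [tree x] are the witnesses that [x] lies in the analytic set coded by
   [x]. *)
pose tree (x : set nat) : set (seq nat) :=
  [set t | forall i, i <= size t -> x (pickle (restr x i, take i t))].
have tree_wf x : I_wf (tree x) <->
    ~ exists y : nat -> nat, forall n, x (pickle (restr x n, mkseq y n)).
  rewrite I_wfP; split=> noy [y Hy]; apply: noy; exists y => n.
    exists (mkseq y n); last exact: prefix_refl.
    by move=> i; rewrite size_mkseq => ilen; rewrite take_mkseq.
  have [u tu /prefixP[v uE]] := Hy n; have := tu n.
  rewrite uE size_cat size_mkseq leq_addr take_size_cat ?size_mkseq//.
  exact.
move=> bI; have /analytic_borel[P HP] : borel_family [set x | I_wf (tree x)].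
  apply: borel_family_preimage bI => t.
  apply: sigma_forall => i; apply: sigma_imply => _.
  (* The coordinate to be read depends on [x] through [restr x i], hence a union over the countably
     many possible values [s]. *)
  rewrite (_ : (fun x => _) = [set x | exists s : seq bool,
      (forall j, j < i -> x j <-> nth false s j) /\
      (size s = i /\ x (pickle (s, take i t)))]); last first.
    apply/seteqP; split=> x /=.
      move=> xi; exists (restr x i); rewrite size_mkseq; split=> // j ji.
      by rewrite nth_mkseq//; split=> /asboolP.
    case=> s [sx [si]]; rewrite (_ : restr x i = s)//.
    apply: (@eq_from_nth _ false); rewrite size_mkseq// => j ji.
    by rewrite nth_mkseq//; apply/idP/idP => [/asboolP /sx|/sx /asboolP]; apply.
  apply: sigma_exists => s; apply: sigma_and.
    apply: sigma_forall => j; apply: sigma_imply => _.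
    by apply: sigma_iff; exact: borel_family_mem.
  by apply: sigma_and; [exact: sigma_cst|exact: borel_family_mem].
(* The code of [P]: [d] lies in the set it codes iff [tree d] is in [I_wf], that is, iff it does
   not. *)
pose d : set nat := [set m | if unpickle m is Some (s, t) then P s t else False].
have dE s t : d (pickle (s, t)) = P s t by rewrite /d /= pickleK.
have dP : (exists y : nat -> nat, forall n, d (pickle (restr d n, mkseq y n))) <->
    exists y : nat -> nat, forall n, P (restr d n) (mkseq y n).
  by split=> -[y Hy]; exists y => n; have := Hy n; rewrite dE.
by have := HP d; have := tree_wf d; rewrite /=; tauto.
Qed.

(** * The class B *)

(** A partition of [nat] together with an enumeration of each piece, free of subtypes. *)
Definition tiling (D : set nat) (h : nat -> nat -> nat) :=
  (forall m, exists n k, D n /\ h n k = m) /\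
  (forall n n' k k', D n -> D n' -> h n k = h n' k' -> n = n' /\ k = k').

Lemma is_direct_sumP (D : set nat) (I : nat -> set (set nat)) S :
  is_direct_sum D I S <->
  exists2 h, tiling D h & S = [set E | forall n, D n -> I n (h n @^-1` E)].
Proof.
split=> [[K [I' [[KT tK _] iso SE]]]|[h [hsurj hinj] ->]].
  have /choice[h Hh] n : exists f : nat -> nat, D n ->
      [/\ injective f, range f = K n &
          forall E, I n (f @^-1` E) <-> I' n (set_val @^-1` E)].
    have [Dn|nDn] := pselect (D n); last by exists id.
    have [g gbij gI] := iso n Dn; exists (set_val \o g) => _; split.
    - exact: inj_comp val_inj (bij_inj gbij).
    - apply/seteqP; split=> [_ [k _ <-]|m Km]; first exact: set_valP.
      have [g' _ gK] := gbij; have Km' := mem_set Km.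
      by exists (g' (SigSub Km')) => //=; rewrite gK.
    move=> E; rewrite gI comp_preimage image_preimage//.
    apply/seteqP; split=> // u _; have [g' _ gK] := gbij.
    by exists (g' u).
  exists h; first split.
  - move=> m; have [n Dn Kn] : cover D K m by rewrite KT.
    have [_ hK _] := Hh n Dn; move: Kn; rewrite -hK => -[k _ hk].
    by exists n, k.
  - move=> n n' k k' Dn Dn' hE; have [_ hK _] := Hh n Dn.
    have [hinj hK' _] := Hh n' Dn'.
    have nn' : n = n'.
      apply: tK => //; exists (h n k); rewrite -hK -hK'.
      by split; [exists k|exists k'; rewrite // hE].
    by split=> //; apply: hinj; rewrite -hE nn'.
  rewrite SE; apply/seteqP; split=> E /= HE n Dn; have [_ _ hI] := Hh n Dn.
    exact/hI/HE.
  by apply/hI; exact: HE.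
exists (fun n => range (h n)), (fun n => [set H | I n (h n @^-1` (set_val @` H))]).
have preK n (E : set nat) :
    h n @^-1` (set_val @` ((set_val : range (h n) -> nat) @^-1` E)) = h n @^-1` E.
  apply/seteqP; split=> k /= => [[u Eu <-//]|Ehk].
  have hk : h n k \in range (h n) by rewrite inE; exists k.
  by exists (SigSub hk).
split; first split.
- apply/seteqP; split=> // m _; have [n [k [Dn <-]]] := hsurj m.
  by exists n => //; exists k.
- move=> n n' Dn Dn' [_ [[k _ <-] [k' _ hE]]].
  by have [->] := hinj _ _ _ _ Dn' Dn hE.
- by move=> n _; exists (h n 0); exists 0.
- move=> n Dn; have hP k : h n k \in range (h n) by rewrite inE; exists k.
  exists (fun k => SigSub (hP k) : range (h n)).
    have hP' (u : range (h n)) : exists k, h n k = set_val u.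
      by have [k _] := set_valP u; exists k.
    have [h' hK] := choice hP'; exists h' => k; last by apply: val_inj; exact: hK.
    by have [] := hinj n n (h' (SigSub (hP k))) k Dn Dn (hK _).
  move=> E /=; rewrite (_ : _ @^-1` _ = E)//.
  apply/seteqP; split=> k /=.
    by move=> [_ [k' Ek' <-] /= hE]; have [_ <-] := hinj _ _ _ _ Dn Dn hE.
  by move=> Ek; exists (SigSub (hP k)) => //; exists k.
by apply/seteqP; split=> E /= HE n Dn; have := HE n Dn; rewrite preK.
Qed.

Lemma classB_finite : classB [set E : set nat | finite_set E].
Proof. by move=> M [_]; apply. Qed.

Lemma classB_orth J : classB J -> classB (iorth J).
Proof. by move=> BJ M [[? Mo ?] ?]; apply: (Mo); exact: BJ. Qed.

Lemma classB_sum D h (I : nat -> set (set nat)) : tiling D h ->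
  (forall n, D n -> classB (I n)) ->
  classB [set E | forall n, D n -> I n (h n @^-1` E)].
Proof.
move=> Dh BI M [[Mi Mo Ms] Mf]; apply: (Ms D I); last by apply/is_direct_sumP; exists h.
by move=> n Dn; apply: BI.
Qed.

(** * Members of B are Borel *)

Lemma is_ideal_orth (X : Type) (I : set (set X)) : is_ideal (iorth I).
Proof.
split=> [E fE A _|E F EF IF A IA|E F IE IF A IA].
- exact: sub_finite_set fE.
- by apply: sub_finite_set (IF A IA) => x [Ax /EF].
- by rewrite setIUr finite_setU; split; [exact: IE|exact: IF].
Qed.

Lemma sub_orth_orth (X : Type) (I : set (set X)) : I `<=` iorth (iorth I).
Proof. by move=> E IE A oA; rewrite setIC; exact: oA. Qed.

(** A condition symmetric in [J] and [iorth J], hence stable under orthogonals. *)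
Definition bireflexive_borel (J : set (set nat)) :=
  [/\ is_ideal J, borel_family J, borel_family (iorth J) & iorth (iorth J) = J].

Lemma bireflexive_borel_orth J : bireflexive_borel J -> bireflexive_borel (iorth J).
Proof. by case=> iJ bJ boJ ooJ; split; rewrite ?ooJ//; exact: is_ideal_orth. Qed.

Lemma orth_finite (X : Type) : iorth [set E : set X | finite_set E] = setT.
Proof. by apply/seteqP; split=> // E _ A /sub_finite_set; apply; exact: subIsetl. Qed.

Lemma finite_set_nat_bounded (E : set nat) :
  finite_set E -> exists n, forall m, n <= m -> ~ E m.
Proof.
move=> /finite_seqP[s ->]; exists (\max_(i <- s) i).+1 => m ltm ms.
by move: ltm; rewrite ltnNge (leq_bigmax_seq (F := id)).
Qed.

Lemma bireflexive_borel_finite : bireflexive_borel [set E | finite_set E].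
Proof.
split.
- by split=> [//|E F EF|E F fE fF] /=; [exact: sub_finite_set|rewrite finite_setU].
- rewrite (_ : mkset _ = [set E | exists n : nat, forall m, n <= m ->
      (~` [set E | E m]) E]).
    apply: sigma_exists => n; apply: sigma_forall => m; apply: sigma_imply => _.
    apply: sigma_not; exact: borel_family_mem.
  apply/seteqP; split=> E /=.
    exact: finite_set_nat_bounded.
  move=> [n En]; apply: (sub_finite_set _ (finite_II n)) => m Em /=.
  by rewrite ltnNge; apply/negP => /En.
- by rewrite orth_finite (_ : setT = [set _ | True]) //; exact: sigma_cst.
rewrite orth_finite; apply/seteqP; split=> E.
  by move=> /(_ setT); rewrite setTI; exact.
by move=> fE A _; exact: sub_finite_set fE.
Qed.

Lemma tiling_inj D h n : tiling D h -> D n -> injective (h n).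
Proof. by move=> [_ hinj] Dn k k' /(hinj _ _ _ _ Dn Dn)[]. Qed.

Lemma tiling_preimage D h n n' (G : set nat) : tiling D h -> D n -> D n' ->
  h n' @^-1` (h n @` G) = if n == n' then G else set0.
Proof.
move=> [_ hinj] Dn Dn'; apply/seteqP; split=> k /=.
  by move=> [k' Gk'] /(hinj _ _ _ _ Dn Dn')[-> <-]; rewrite eqxx.
by case: eqP => [->|//] Gk; exists k.
Qed.

(** A set is orthogonal to the sum iff it meets finitely many pieces, each in a set orthogonal to
    the summand; this is a Borel condition. *)
Lemma bireflexive_borel_sum D h (I : nat -> set (set nat)) : tiling D h ->
  (forall n, D n -> bireflexive_borel (I n)) ->
  bireflexive_borel [set E | forall n, D n -> I n (h n @^-1` E)].
Proof.
move=> Dh BI; set S := mkset _.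
have iS : is_ideal S.
  split=> [E fE|E F EF SF|E F SE SF] n Dn; have [[If Is Iu] _ _ _] := BI n Dn.
  - by apply/If/finite_preimage => //; apply: in2W; exact: tiling_inj Dh Dn.
  - by apply: Is (SF n Dn); exact: preimage_subset.
  - by rewrite preimage_setU; apply: Iu; [exact: SE|exact: SF].
have Sin n G : D n -> I n G -> S (h n @` G).
  move=> Dn IG n' Dn'; rewrite (tiling_preimage _ Dh Dn Dn'); case: eqP => [<-//|_].
  by have [[If _ _] _ _ _] := BI n' Dn'; exact: If.
have image_pre n (A G : set nat) : h n @` (A `&` h n @^-1` G) = h n @` A `&` G.
  apply/seteqP; split=> [_ [k [Ak Gk] <-]|_ [[k Ak <-] Gk]]; last by exists k.
  by split=> //; exists k.
have fin_pre n (A : set nat) : D n -> finite_set (h n @` A) -> finite_set A.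
  move=> Dn /(finite_preimage (in2W (tiling_inj Dh Dn))).
  by apply: sub_finite_set => k Ak; exists k.
have SoE : iorth S = [set B | (forall n, D n -> iorth (I n) (h n @^-1` B)) /\
    exists m : nat, forall n, m <= n -> D n -> forall k, (~` [set B | B (h n k)]) B].
  apply/seteqP; split=> B.
    move=> oB; split=> [n Dn A IA|].
      by apply: (fin_pre n) => //; rewrite image_pre; apply: oB; exact: Sin.
    have [idx Hidx] := choice Dh.1.
    have idxE n k : D n -> idx (h n k) = n.
      move=> Dn; have [k' [Di hE]] := Hidx (h n k).
      by have [] := Dh.2 _ _ _ _ Di Dn hE.
    pose C n := D n /\ exists k, B (h n k).
    have /choice[g Hg] n : exists k, C n -> B (h n k).
      by have [[_ [k Bk]]|nC] := pselect (C n); [exists k|exists 0].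
    (* One point of [B] in each piece that [B] meets: with at most one point per piece, this set is
       in the sum, so its trace on [B] is finite. *)
    have SA : S [set m | exists2 n, C n & m = h n (g n)].
      move=> n Dn; have [[If _ _] _ _ _] := BI n Dn; apply: If.
      apply: (sub_finite_set _ (finite_set1 (g n))) => k /= [n' [Dn' _] hE].
      by have [-> ->] := Dh.2 _ _ _ _ Dn Dn' hE.
    have /(finite_image idx)/finite_set_nat_bounded[m Hm] := oB _ SA.
    exists m => n mn Dn k Bk; apply: (Hm n mn).
    have Cn : C n by split=> //; exists k.
    by exists (h n (g n)); [split; [exists n|exact: Hg]|exact: idxE].
  move=> [oB [m Hm]] A SA.
  apply: (@sub_finite_set _ _
      (\bigcup_(n in [set n | n < m /\ D n]) h n @` (h n @^-1` A `&` h n @^-1` B))).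
    move=> b [Ab Bb]; have [n [k [Dn hE]]] := Dh.1 b; rewrite -hE in Ab Bb.
    exists n; last by exists k.
    by split=> //; rewrite ltnNge; apply/negP => mn; exact: (Hm n mn Dn k).
  apply: bigcup_finite.
    by apply: (sub_finite_set _ (finite_II m)) => n [].
  by move=> n [_ Dn]; apply: finite_image; apply: oB => //; exact: SA.
split=> //.
- apply: sigma_forall => n; apply: sigma_imply => Dn.
  have [_ bI _ _] := BI n Dn; apply: borel_family_preimage bI => k.
  exact: borel_family_mem.
- rewrite SoE; apply: sigma_and.
    apply: sigma_forall => n; apply: sigma_imply => Dn.
    have [_ _ bI _] := BI n Dn; apply: borel_family_preimage bI => k.
    exact: borel_family_mem.
  apply: sigma_exists => m; apply: sigma_forall => n; do 2!apply: sigma_imply => ?.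
  by apply: sigma_forall => k; apply: sigma_not; exact: borel_family_mem.
apply/seteqP; split; last exact: sub_orth_orth.
(* The image under [h n] of a set orthogonal to [I n] is orthogonal to the sum. *)
move=> C ooC n Dn; have [_ _ _ <-] := BI n Dn => G oG.
apply: (fin_pre n) => //; rewrite image_pre; apply: ooC => A SA.
by rewrite setIC -image_pre setIC; apply: finite_image; apply: oG; exact: SA.
Qed.

Lemma classB_bireflexive_borel J : classB J -> bireflexive_borel J.
Proof.
apply; split; last by move=> _ ->; exact: bireflexive_borel_finite.
split=> [I []//||D I S BI /is_direct_sumP[h Dh ->]].
  exact: bireflexive_borel_orth.
exact: bireflexive_borel_sum.
Qed.

Lemma isomorphic_borel (X Y : Type) (I : set (set X)) (J : set (set Y)) :
  isomorphic I J -> borel_family J -> borel_family I.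
Proof.
move=> [f [g fK gK] IJ] bJ.
rewrite (_ : I = [set E | J (g @^-1` E)]); last first.
  apply/seteqP; split=> E /=; rewrite IJ (_ : f @` E = g @^-1` E)//;
  by apply/seteqP; split=> [_ [x Ex <-]|y Ey] /=; rewrite ?fK//; exists (g y).
by apply: borel_family_preimage bJ => y; exact: borel_family_mem.
Qed.

Lemma belongs_to_B_borel (X : Type) (I : set (set X)) :
  belongs_to_B I -> borel_family I.
Proof. by move=> [J /classB_bireflexive_borel[_ bJ _ _]] /isomorphic_borel; exact. Qed.

(** * Subsets on which an ideal belongs to B *)

Definition enumerates (X : Type) (f : nat -> X) (K : set X) :=
  injective f /\ range f = K.

(** The restriction is transported to [nat] by an enumeration, which avoids subtypes and forces [K]
    to be infinite. *)
Definition in_B (X : Type) (I : set (set X)) (K : set X) :=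
  exists2 f : nat -> X, enumerates f K & classB [set E | I (f @` E)].

Lemma in_B_belongs (X : Type) (I : set (set X)) (K : set X) :
  in_B I K -> belongs_to_B (irestrict I K).
Proof.
move=> [f [finj fK] BI]; exists [set E | I (f @` E)] => //.
have mem m : f m \in K by rewrite inE -fK; exists m.
have /choice[g Hg] (u : K) : exists m, f m = set_val u.
  by have := set_valP u; rewrite -[X in X _]fK => -[m _]; exists m.
exists g => [|E].
  exists (fun m => SigSub (mem m) : K) => [u|m]; first by apply: val_inj; exact: Hg.
  by apply: finj; rewrite Hg.
rewrite /= /irestrict /= (_ : f @` (g @` E) = set_val @` E)//.
apply/seteqP; split=> [_ [_ [u Eu <-] <-]|_ [u Eu <-]]; first by exists u.
by exists (g u) => //; exists u.
Qed.

Lemma infinite_enumerates (X : countType) (K : set X) :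
  infinite_set K -> exists f : nat -> X, enumerates f K.
Proof.
move=> infK; have /card_bijP[f [g fK gK]] := eq_card_nat (countableP K) infK.
have memT m : m \in [set: nat] by rewrite inE.
exists (fun m => set_val (g (SigSub (memT m)))); split.
  by move=> m m' /val_inj /(can_inj gK) [].
apply/seteqP; split=> [_ [m _ <-]|x Kx]; first exact: set_valP.
exists (set_val (f (SigSub (mem_set Kx)))) => //.
rewrite (_ : SigSub _ = f (SigSub (mem_set Kx))) ?fK//; exact: val_inj.
Qed.

Lemma enumerates_infinite (X : Type) (f : nat -> X) (K : set X) :
  enumerates f K -> infinite_set K.
Proof.
move=> [finj <-] /(finite_preimage (in2W finj)) fin; apply: infinite_nat.
by apply: sub_finite_set fin => m _; exists m.
Qed.

(** The restriction is the full power set, the orthogonal of the ideal of finite sets. *)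
Lemma in_B_finite (X : countType) (I : set (set X)) (K : set X) :
  infinite_set K -> (forall E, E `<=` K -> I E) -> in_B I K.
Proof.
move=> /infinite_enumerates[f [finj fK]] IE; exists f => //.
rewrite (_ : mkset _ = iorth [set E | finite_set E]).
  by apply: classB_orth; exact: classB_finite.
rewrite orth_finite; apply/seteqP; split=> // E _; apply: IE.
by rewrite -fK; exact: image_subset.
Qed.

Lemma in_B_orth (X : Type) (I : set (set X)) (K : set X) :
  (forall E F, E `<=` F -> I F -> I E) -> in_B I K -> in_B (iorth I) K.
Proof.
move=> Is [f [finj fK] BI]; exists f => //.
rewrite (_ : mkset _ = iorth [set E | I (f @` E)]); first exact: classB_orth.
apply/seteqP; split=> E /= oE A IA.
  have /(finite_preimage (in2W finj)) := oE _ IA.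
  by apply: sub_finite_set => m [Am Em]; split; exists m.
have IA' : I (f @` (f @^-1` A)) by apply: Is IA => _ [m Am <-].
apply: sub_finite_set (finite_image f (oE _ IA')).
by move=> x [Ax [m Em fm]]; exists m => //; split=> //; rewrite /= fm.
Qed.

(** An enumeration of the union turns enumerations of the pieces into a tiling of [nat]. *)
Lemma in_B_sum (X : countType) (I : set (set X)) (D : set nat)
    (P : nat -> set X) :
  D !=set0 -> trivIset D P -> (forall n, D n -> in_B I (P n)) ->
  (forall E, E `<=` \bigcup_(n in D) P n ->
    I E <-> forall n, D n -> I (E `&` P n)) ->
  in_B I (\bigcup_(n in D) P n).
Proof.
move=> [n0 Dn0] tP BP IP; set K := \bigcup_(n in D) P n in IP *.
have /infinite_enumerates[f [finj fK]] : infinite_set K.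
  have [g /enumerates_infinite infP _] := BP n0 Dn0.
  by apply: sub_infinite_set infP => x Px; exists n0.
have /choice[h Hh] n : exists h : nat -> nat, D n ->
    enumerates (f \o h) (P n) /\ classB [set E | I (f @` (h @` E))].
  have [Dn|nDn] := pselect (D n); last by exists id.
  have [g [ginj gP] Bg] := BP n Dn.
  have /choice[h Hh] k : exists m, f m = g k.
    suff [m _ mE] : range f (g k) by exists m.
    by rewrite fK; exists n => //; rewrite -gP; exists k.
  have fh : f \o h = g by apply/funext => k /=.
  exists h => _; rewrite fh; split=> //.
  by rewrite (_ : mkset _ = [set E | I (g @` E)])//; apply/funext => E /=;
     rewrite image_comp fh.
exists f => //.
have til : tiling D h.
  split=> [m|n n' k k' Dn Dn' hE].
    have [n Dn] : K (f m) by rewrite -fK; exists m.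
    have [[_ <-] _] := Hh n Dn => -[k _ /finj hE].
    by exists n, k.
  have [[inj1 r1] _] := Hh n Dn; have [[inj2 r2] _] := Hh n' Dn'.
  have nn' : n = n'.
    apply: tP => //; exists (f (h n k)); rewrite -r1 -r2.
    by split; [exists k|exists k'; rewrite //= hE].
  by split=> //; apply: inj1; rewrite /= hE nn'.
have := classB_sum til (fun n Dn => (Hh n Dn).2).
rewrite (_ : mkset _ = [set E | I (f @` E)])//; apply/seteqP.
have imE n (E : set nat) : D n -> f @` (h n @` (h n @^-1` E)) = f @` E `&` P n.
  move=> Dn; have [[_ r1] _] := Hh n Dn; rewrite -r1.
  apply/seteqP; split=> [_ [_ [k Ek <-] <-]|_ [[m Em <-] [k _ /finj hE]]].
    by split; [exists (h n k)|exists k].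
  by exists (h n k); [exists k; rewrite //= hE|rewrite -hE].
have sub (E : set nat) : f @` E `<=` K by rewrite -fK; exact: image_subset.
split=> E /= HE.
  by apply/IP => // n Dn; rewrite -imE//; exact: HE.
by move=> n Dn; rewrite imE//; apply: (IP _ (sub E)).1.
Qed.

(* Summands of a direct sum are infinite, so finite pieces of a partition have
   to be merged into another piece: hence the quantification over [F]. *)
Definition good (X : Type) (I : set (set X)) (K : set X) :=
  finite_set K \/ forall F, finite_set F -> in_B I (K `|` F).

Lemma good_in_B (X : Type) (I : set (set X)) (K : set X) :
  infinite_set K -> good I K -> in_B I K.
Proof. by move=> infK [//|/(_ set0 (finite_set0 _))]; rewrite setU0. Qed.

Lemma good_orth (X : Type) (I : set (set X)) (K : set X) :
  (forall E F, E `<=` F -> I F -> I E) -> good I K -> good (iorth I) K.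
Proof.
by move=> Is [fK|gK]; [left|right=> F /gK; exact: in_B_orth].
Qed.

(** The infinite pieces are summands; the rest [U], contained in [F] and the finite pieces, is
    absorbed by a single summand, of index [p]. *)
Lemma good_sum (X : countType) (I : set (set X)) (P : nat -> set X) :
  is_ideal I -> trivIset setT P -> (forall n, good I (P n)) ->
  (forall E, E `<=` \bigcup_n P n -> (forall n, I (E `&` P n)) -> I E) ->
  good I (\bigcup_n P n).
Proof.
move=> [If Is Iu] tP gP IP; set K := \bigcup_n P n in IP *.
have [|infK] := pselect (finite_set K); [by left|right=> F finF].
pose D := [set n | infinite_set (P n)].
pose P' n := [set x | D n /\ P n x].
pose U := (K `|` F) `\` \bigcup_n P' n.
pose Q p n := [set x | P' n x \/ n = p /\ U x].
have IKF E : E `<=` K `|` F -> (forall n, D n -> I (E `&` P n)) -> I E.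
  move=> EKF IE; rewrite (_ : E = (E `&` K) `|` (E `&` F)); last first.
    by rewrite -setIUr; apply/esym/setIidPl.
  apply: Iu; last by apply/If/(sub_finite_set _ finF) => x [].
  apply: IP => [|n]; first exact: subIsetr.
  have [Dn|/contrapT finP] := pselect (D n).
    by apply: Is (IE n Dn) => x [[Ex _] Px].
  by apply/If/(sub_finite_set _ finP) => x [].
have [p Bp] : exists p, in_B I (Q p p).
  (* A finite rest is added to an infinite piece, as goodness allows. An infinite one, all of whose
     subsets are in [I], becomes a summand at the free index of a finite piece. *)
  have [finU|infU] := pselect (finite_set U).
    have [p Dp] : exists p, D p.
      apply: contrapT => noD; apply: infK; apply: (sub_finite_set _ finU) => x Kx.
      by split; [left|case=> n _ [Dn _]; apply: noD; exists n].
    exists p; rewrite (_ : Q p p = P p `|` U).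
      by have [|] := gP p; [move=> /Dp|exact].
    apply/seteqP; split=> x /=; first by case=> [[_ ?]|[_ ?]]; [left|right].
    by case; [left|right].
  have [p nDp] : exists p, ~ D p.
    apply: contrapT => /forallNP allD; apply: infU; apply: (sub_finite_set _ finF).
    move=> x [[[n _ Px]|//] []]; exists n => //.
    by split=> //; apply: contrapT; exact: allD.
  exists p; rewrite (_ : Q p p = U).
    apply: in_B_finite infU _ => E EU; apply: IKF => [x /EU []//|n Dn].
    rewrite (_ : _ `&` _ = set0); first exact/If/finite_set0.
    by apply/seteqP; split=> // x [/EU [_ nx] Px]; apply: nx; exists n.
  by apply/seteqP; split=> x /=; [case=> [[/nDp]|[]]|right].
have KFE : K `|` F = \bigcup_(n in D `|` [set p]) Q p n.
  apply/seteqP; split=> [x KFx|x [n _ [[Dn Px]|[_ []]//]]]; last by left; exists n.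
  have [[n _ Pn]|nP] := pselect ((\bigcup_n P' n) x).
    by exists n; [left; case: Pn|left].
  by exists p; right.
rewrite KFE; apply: in_B_sum.
- by exists p; right.
- move=> n m _ _ [x [[[Dn Pn]|[-> [_ nx]]] [[Dm Pm]|[-> [_ nx']]]]] //.
  + by apply: tP => //; exists x.
  + by case: nx'; exists n.
  + by case: nx; exists m.
- move=> n; have [-> //|np] := pselect (n = p).
  case=> // Dn; rewrite (_ : Q p n = P n); first exact: good_in_B.
  by apply/seteqP; split=> x /=; [case=> [[]|[]]|left].
move=> E; rewrite -KFE => EKF; split=> [IE n _|HE]; first exact: Is IE.
apply: IKF => // n Dn; apply: Is (HE n (or_introl Dn)) => x [Ex Px].
by split=> //; left.
Qed.

(** * Bad nodes *)

Lemma prefix_nth (T : eqType) (x0 : T) (s t : seq T) i :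
  prefix s t -> i < size s -> nth x0 t i = nth x0 s i.
Proof. by move=> /prefixP[r ->] lt; rewrite nth_cat lt. Qed.

Lemma prefix_rcons_nth (s t : seq nat) m :
  prefix (rcons s m) t -> nth 0 t (size s) = m.
Proof. by move/prefix_nth => ->; rewrite ?size_rcons// nth_rcons ltnn eqxx. Qed.

Lemma prefix_mkseq (x : nat -> nat) i n :
  i <= n -> prefix (mkseq x i) (mkseq x n).
Proof. by move=> ilen; rewrite -(take_mkseq x ilen) prefix_take. Qed.

Lemma prefix_leq (T : eqType) (s t u : seq T) :
  prefix s u -> prefix t u -> size s <= size t -> prefix s t.
Proof.
rewrite !prefixE => /eqP su /eqP tu st; apply/eqP.
by rewrite -tu take_takel.
Qed.

Lemma prefix_chain_limit (s : nat -> seq nat) :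
  (forall n, prefix (s n) (s n.+1)) -> (forall n, n <= size (s n)) ->
  exists x : nat -> nat, forall n, prefix (mkseq x n) (s n).
Proof.
(* The [i]-th entry of the limit is read off [s i.+1], which is long enough to have it. *)
move=> sS ssize; exists (fun i => nth 0 (s i.+1) i) => n.
have mono i j : i <= j -> prefix (s i) (s j).
  move=> /subnK <-; elim: (j - i) => [|k IH]; first exact: prefix_refl.
  exact: prefix_trans IH (sS _).
rewrite prefixE size_mkseq; apply/eqP/(@eq_from_nth _ 0).
  by rewrite size_takel ?size_mkseq.
move=> i; rewrite size_takel// => lt_in; rewrite nth_take// nth_mkseq//.
exact: prefix_nth (mono _ _ lt_in) (ssize _).
Qed.

Lemma branch_exists (Q : seq nat -> Prop) t :
  Q t -> (forall v, Q v -> exists m, Q (rcons v m)) ->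
  exists x : nat -> nat, forall n, exists2 v, Q v & prefix (mkseq x n) v.
Proof.
move=> Qt QS; have /choice[next Hnext] v : exists m, Q v -> Q (rcons v m).
  by have [/QS[m Qm]|nQ] := pselect (Q v); [exists m|exists 0].
pose s n := iter n (fun v => rcons v (next v)) t.
have [||x xs] := @prefix_chain_limit s.
- by move=> n; exact: prefix_rcons.
- by elim=> // n IH; rewrite /= size_rcons ltnS.
exists x => n; exists (s n) => //.
by elim: n => //= n IH; exact: Hnext.
Qed.

(** * The well founded ideal and its double orthogonal *)

Lemma is_ideal_I_wf : is_ideal I_wf.
Proof.
split=> [E /finite_seqP[s ->]|E F EF|E F].
- apply/I_wfP => -[x /(_ (\max_(u <- s) size u).+1)[u /= us /size_prefix]].
  by rewrite size_mkseq ltnNge (leq_bigmax_seq (F := size)).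
- move=> /I_wfP noF; apply/I_wfP => -[x Ex]; apply: noF; exists x => n.
  by have [u Eu xu] := Ex n; exists u => //; exact: EF.
move=> /I_wfP noE /I_wfP noF; apply/I_wfP => -[x EFx].
(* If [x] is not a cluster point of [E], the elements of the union far enough along [x] lie in
   [F]. *)
have [Ex|/existsNP[n nE]] := pselect (clusters_at E x); first by apply: noE; exists x.
apply: noF; exists x => m; have [u [Eu|Fu] xu] := EFx (maxn n m).
  case: nE; exists u => //; apply: prefix_trans xu.
  by apply: prefix_mkseq; exact: leq_maxl.
exists u => //; apply: prefix_trans xu.
by apply: prefix_mkseq; exact: leq_maxr.
Qed.

(** A set outside [I_wf] contains elements [e n] converging to a cluster point; their range is
    infinite but orthogonal to [I_wf]. *)
Lemma I_wf_orth_orth : iorth (iorth I_wf) = I_wf.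
Proof.
apply/seteqP; split; last exact: sub_orth_orth.
move=> E ooE; apply/I_wfP => -[x Ex].
have /choice[e He] n : exists u, E u /\ prefix (mkseq x n) u.
  by have [u Eu xu] := Ex n; exists u.
have finE : finite_set (range e).
  have : iorth I_wf (range e).
    move=> F /I_wfP noF; have /existsNP[n Fn] : ~ clusters_at F x.
      by move=> Fx; apply: noF; exists x.
    apply: (sub_finite_set _ (finite_image e (finite_II n))) => u [Fu [k _ ek]].
    exists k => //=; rewrite ltnNge; apply/negP => nk; apply: Fn; exists (e k).
      by rewrite ek.
    exact: prefix_trans (prefix_mkseq x nk) (He k).2.
  move=> /ooE; rewrite (_ : range e `&` E = range e)//.
  by apply/setIidPl => _ [k _ <-]; exact: (He k).1.
have [n Hn] := finite_set_nat_bounded (finite_image size finE).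
apply: (Hn (size (e n))); last by exists (e n) => //; exists n.
by have := size_prefix (He n).2; rewrite size_mkseq.
Qed.

(** A cluster point [x] of a set is also one of the piece lying over [mkseq x N], so membership in
    [I_wf] is decided piecewise. *)
Lemma good_take (N : nat) (K : set (seq nat)) :
  (forall w, good I_wf (K `&` [set u | take N u = w])) -> good I_wf K.
Proof.
move=> gK; pose P n := [set u | K u /\ pickle (take N u) = n].
have KP : K = \bigcup_n P n.
  by apply/seteqP; split=> [u Ku|u [n _ []//]]; exists (pickle (take N u)).
rewrite KP; apply: good_sum.
- exact: is_ideal_I_wf.
- by move=> n n' _ _ [u [[_ <-] [_ <-]]].
- move=> n; have [[w wn]|nw] := pselect (exists w : seq nat, pickle w = n).
    rewrite (_ : P n = K `&` [set u | take N u = w])//.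
    apply/seteqP; rewrite -wn; split=> u /= [Ku]; last by move=> uw; split; rewrite ?uw.
    by move=> /(pcan_inj pickleK).
  left; apply: (sub_finite_set _ (finite_set0 _)) => u [_ un].
  by apply: nw; exists (take N u).
move=> E EK HE; apply/I_wfP => -[x Ex].
have /I_wfP := HE (pickle (mkseq x N)); apply; exists x => n.
have [u Eu xu] := Ex (maxn n N); exists u.
  split=> //; split; first by rewrite KP; exact: EK.
  have := prefix_trans (prefix_mkseq x (leq_maxr n N)) xu.
  by rewrite prefixE size_mkseq => /eqP ->.
exact: prefix_trans (prefix_mkseq x (leq_maxl n N)) xu.
Qed.

(** * Koenig's lemma on the bad nodes *)

Definition cone (A : set (seq nat)) (t : seq nat) := [set u | A u /\ prefix t u].

(** The quantification over [u] makes badness pass to initial segments. *)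
Definition bad (A : set (seq nat)) (t : seq nat) :=
  exists2 u, prefix t u & ~ good I_wf (cone A u).

Lemma prefix_bad A s t : prefix s t -> bad A t -> bad A s.
Proof. by move=> st [u tu nu]; exists u => //; exact: prefix_trans tu. Qed.

Lemma good_not_bad A t : ~ bad A t -> good I_wf (cone A t).
Proof.
move=> nb; apply: contrapT => ng; apply: nb; exists t => //.
exact: prefix_refl.
Qed.

(** Koenig's lemma: otherwise one climbs through bad nodes towards a cluster point of [F]. *)
Lemma finite_wf_levels A t (F : set (seq nat)) :
  (forall v, prefix t v -> finite_set [set m | bad A (rcons v m)]) -> I_wf F ->
  exists n, forall u, F u -> cone A t u -> n <= size u -> ~ bad A (take n u).
Proof.
move=> finbr /I_wfP noF; apply: contrapT => /forallNP far; apply: noF.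
pose W n u := [/\ F u, cone A t u, n <= size u & bad A (take n u)].
have W_le m n u : m <= n -> W n u -> W m u.
  move=> mn [Fu Au nu bu]; split=> //; first exact: leq_trans nu.
  by apply: prefix_bad bu; rewrite -(take_takel u mn) prefix_take.
pose Q v := prefix t v /\ forall n, exists2 u, W n u & prefix v u.
have Qt : Q t.
  split=> [|n]; first exact: prefix_refl.
  have /existsNP[u /not_implyP[Fu /not_implyP[Au /not_implyP[nu /contrapT bu]]]] := far n.
  by exists u; [split|exact: Au.2].
have [|x Hx] := branch_exists Qt.
  move=> v [tv Qv]; apply: contrapT => /forallNP noQ.
  (* A child that fails does so at some level [k m]. [N] bounds these levels for the finitely many
     bad children, yet an element of [W] at a level beyond [N] and the length of [v] passes through
     one of them. *)
  have /choice[k Hk] m : exists k, forall u, W k u -> ~ prefix (rcons v m) u.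
    apply: contrapT => /forallNP Wm; apply: (noQ m); split.
      by apply: prefix_trans tv _; exact: prefix_rcons.
    move=> n; have /existsNP[u /not_implyP[Wu /contrapT vu]] := Wm n.
    by exists u.
  have [N HN] := finite_set_nat_bounded (finite_image k (finbr v tv)).
  have [u Wu vu] := Qv (maxn N (size v).+1).
  have [_ _ Nu _] := Wu; have vltu : size v < size u.
    by apply: leq_trans Nu; exact: leq_maxr.
  have [r uE] := prefixP vu; case: r uE => [|m r] uE.
    by move: vltu; rewrite uE cats0 ltnn.
  have vmu : prefix (rcons v m) u by rewrite uE -cat_rcons prefix_prefix.
  apply: (Hk m u _ vmu); apply: (W_le _ _ _ _ Wu); rewrite leq_max ltnW// ltnNge.
  apply/negP => Nk; apply: (HN _ Nk); exists m => //=.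
  have [_ _ _] := W_le _ _ _ (leq_maxr _ _) Wu.
  by move: vmu; rewrite prefixE size_rcons => /eqP ->.
exists x => n; have [v [_ Qv] xv] := Hx n; have [u [Fu _ _ _] vu] := Qv 0.
by exists u => //; exact: prefix_trans vu.
Qed.

Lemma last_true (P : nat -> Prop) n : P 0 -> ~ P n -> exists k, P k /\ ~ P k.+1.
Proof.
move=> P0; elim: n => // n IH nPn; have [Pn|/IH//] := pselect (P n).
by exists n.
Qed.

(* If all nodes above [t] have finitely many bad children, the set of bad nodes
   is finitely branching; [P k] collects the elements of the cone whose largest
   bad initial segment has length [k]. By Koenig's lemma a set in [I_wf] meets
   finitely many [P k], so on the cone [I_wf] is the orthogonal of the direct
   sum of the orthogonals of its restrictions to the [P k]. *)
Lemma good_finitely_branching A t :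
  (forall v, prefix t v -> finite_set [set m | bad A (rcons v m)]) ->
  good I_wf (cone A t).
Proof.
move=> finbr; have [bt|] := pselect (bad A t); last exact: good_not_bad.
pose R k := [set u | cone A t u /\ (k <= size u /\ bad A (take k u))].
pose P k := R k `\` R k.+1.
have R_le m n u : m <= n -> R n u -> R m u.
  move=> mn [Au [nu bu]]; split=> //; split; first exact: leq_trans nu.
  by apply: prefix_bad bu; rewrite -(take_takel u mn) prefix_take.
have coneE : cone A t = \bigcup_k P k.
  apply/seteqP; split=> [u Au|u [k _ [[]]]//].
  have [||k Pk] := @last_true (fun k => R k u) (size u).+1; last by exists k.
    by split=> //; rewrite take0; split=> //; apply: prefix_bad bt; rewrite prefix0s.
  by move=> [_ []]; rewrite ltnn.
have tP : trivIset setT P.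
  move=> m n _ _ [u [[Rm nRm] [Rn nRn]]]; case: (ltngtP m n) => // mn.
    by case: nRm; exact: R_le Rn.
  by case: nRn; exact: R_le Rm.
have [If Is Iu] := is_ideal_I_wf.
have gP k : good I_wf (P k).
  (* The piece over [w] is either contained in the singleton of [w] or the whole cone of [w], a node
     that is not bad. *)
  apply: (good_take (N := k.+1)) => w.
  have [[u0 [[[[Au0 tu0] [ku0 bu0]] nRu0] wu0 ltu0]]|none] := pselect (exists u,
      [/\ P k u, take k.+1 u = w & k < size u]); last first.
    left; apply: (sub_finite_set _ (finite_set1 w)) => u [Pu /= uw].
    have [ku|uk] := ltnP k (size u); first by case: none; exists u.
    by rewrite -uw take_oversize// ltnW.
  have nbw : ~ bad A w by rewrite -wu0 => bw; apply: nRu0.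
  have tw : prefix t w.
    have wu : prefix w u0 by rewrite -wu0 prefix_take.
    have [/(prefix_leq tu0 wu)//|/ltnW/(prefix_leq wu tu0) wt] := leqP (size t) (size w).
    by case: nbw; exact: prefix_bad bt.
  rewrite (_ : _ `&` _ = cone A w); first exact: good_not_bad.
  have sw : size w = k.+1 by rewrite -wu0 size_takel.
  apply/seteqP; split=> u.
    by move=> [[[[Au _] _] _] /= <-]; split=> //; exact: prefix_take.
  move=> [Au wu]; have uw : take k.+1 u = w.
    by move: wu; rewrite prefixE sw => /eqP.
  split=> //; split; last by case=> _ [_]; rewrite uw.
  split; first by split=> //; exact: prefix_trans wu.
  split; first by rewrite ltnW// -sw; exact: size_prefix.
  by rewrite -(take_takel u (leqnSn k)) uw -wu0 take_takel.
rewrite -I_wf_orth_orth; apply: good_orth; first by have [] := is_ideal_orth I_wf.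
rewrite coneE; apply: good_sum => //; first exact: is_ideal_orth.
  by move=> k; exact: good_orth.
rewrite -coneE => E Et HE F IF.
have [n Fn] := finite_wf_levels finbr IF.
apply: (@sub_finite_set _ _ (\bigcup_(k in [set k | k < n]) (F `&` (E `&` P k)))).
  move=> u [Fu Eu]; have tu := Et _ Eu; move: (tu); rewrite {1}coneE => -[k _ Pk].
  exists k => //=; rewrite ltnNge; apply/negP => nk.
  by have [_ [nu bu]] := R_le _ _ _ nk Pk.1; exact: (Fn u).
by apply: bigcup_finite => [|k _]; [exact: finite_II|exact: HE].
Qed.

Lemma bad_splitting A w : bad A w ->
  exists2 v, prefix w v & infinite_set [set m | bad A (rcons v m)].
Proof.
move=> [u wu ngu]; apply: contrapT => fin; apply: ngu.
apply: good_finitely_branching => v uv; apply: contrapT => infv.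
by apply: fin; exists v => //; exact: prefix_trans uv.
Qed.

Lemma bad_cone A t : bad A t -> exists a, cone A t a.
Proof.
move=> [u tu ngu]; apply: contrapT => nA; apply: ngu; left.
apply: (sub_finite_set _ (finite_set0 _)) => a [Aa ua]; apply: nA.
by exists a; split=> //; exact: prefix_trans ua.
Qed.

(** [p] packs a splitting node, an element of [A] above it, and an enumeration of its bad children
    other than the one below this element. *)
Lemma bad_step A w : bad A w -> exists p : seq nat * seq nat * (nat -> nat),
  [/\ prefix w p.1.1, cone A p.1.1 p.1.2, injective p.2 &
      forall m, bad A (rcons p.1.1 (p.2 m)) /\ ~ prefix (rcons p.1.1 (p.2 m)) p.1.2].
Proof.
move=> /bad_splitting[v wv infv].
have [m0 /bad_cone[a [Aa va]]] := infinite_setN0 infv.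
have inf : infinite_set ([set m | bad A (rcons v m)] `\` [set nth 0 a (size v)]).
  exact: infinite_setD infv (finite_set1 _).
have [e [einj eE]] := infinite_enumerates inf.
exists (v, a, e); split=> //=.
  by split=> //; apply: prefix_trans va; exact: prefix_rcons.
move=> m; have [bm ne] : ([set m | bad A (rcons v m)] `\` [set nth 0 a (size v)]) (e m).
  by rewrite -eE; exists m.
by split=> //; move=> /prefix_rcons_nth /esym.
Qed.

(** * Copying the full tree into the bad nodes *)

Lemma seq_trichotomy (s t : seq nat) : s <> t ->
  [\/ exists m, prefix (rcons s m) t, exists m, prefix (rcons t m) s |
      exists c m n, [/\ m <> n, prefix (rcons c m) s & prefix (rcons c n) t]].
Proof.
elim: s t => [|x s IH] [|y t] // st.
- by constructor 1; exists y; rewrite [rcons _ _]/= prefix_cons eqxx prefix0s.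
- by constructor 2; exists x; rewrite [rcons _ _]/= prefix_cons eqxx prefix0s.
have [xy|/eqP xy] := eqVneq x y; last first.
  constructor 3; exists [::], x, y; split=> //.
    by rewrite [rcons _ _]/= prefix_cons eqxx prefix0s.
  by rewrite [rcons _ _]/= prefix_cons eqxx prefix0s.
subst y; have {st} st' : s <> t by move=> E; apply: st; rewrite E.
have [[m mt]|[m ms]|[c [m [n [mn cs ct]]]]] := IH _ st'.
- by constructor 1; exists m; rewrite rcons_cons prefix_cons eqxx.
- by constructor 2; exists m; rewrite rcons_cons prefix_cons eqxx.
- by constructor 3; exists (x :: c), m, n; rewrite !rcons_cons !prefix_cons !eqxx.
Qed.

(* Above every bad node there is one with infinitely many bad children, so one
   can copy the whole of the tree of finite sequences inside the bad nodes:
   [ph s] is the copy of [s], its children extend [V (ph s)] by distinct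
   integers, and [s] is mapped to an element [a (ph s)] of [A] that extends
   [V (ph s)] but none of these children. *)
Lemma bad_embeds A : bad A [::] -> embeds I_wf (irestrict I_wf A).
Proof.
move=> bad0.
have /choice[p Hp] w : exists p : seq nat * seq nat * (nat -> nat), bad A w ->
  [/\ prefix w p.1.1, cone A p.1.1 p.1.2, injective p.2 &
      forall m, bad A (rcons p.1.1 (p.2 m)) /\ ~ prefix (rcons p.1.1 (p.2 m)) p.1.2].
  have [/bad_step[p Hp]|nb] := pselect (bad A w); first by exists p.
  (* A dummy value: every [ph s] below is bad. *)
  by exists ([::], [::], id).
pose V w := (p w).1.1; pose a w := (p w).1.2; pose e w := (p w).2.
pose ph := foldl (fun w m => rcons (V w) (e w m)) [::].
have phS s m : ph (rcons s m) = rcons (V (ph s)) (e (ph s) m).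
  by rewrite /ph -cats1 foldl_cat.
have bad_ph s : bad A (ph s).
  elim/last_ind: s => [//|s m IH]; rewrite phS.
  by have [_ _ _ /(_ m)[]] := Hp _ IH.
have ph_V s : prefix (ph s) (V (ph s)) by have [] := Hp _ (bad_ph s).
have V_a s : prefix (V (ph s)) (a (ph s)) by have [_ []] := Hp _ (bad_ph s).
have a_A s : A (a (ph s)) by have [_ []] := Hp _ (bad_ph s).
have e_inj s : injective (e (ph s)) by have [] := Hp _ (bad_ph s).
have a_child s m : ~ prefix (ph (rcons s m)) (a (ph s)).
  by rewrite phS; have [_ _ _ /(_ m)[]] := Hp _ (bad_ph s).
have ph_mono s t : prefix s t -> prefix (ph s) (ph t).
  move=> /prefixP[r ->]; elim/last_ind: r => [|r m IH].
    by rewrite cats0; exact: prefix_refl.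
  rewrite -rcons_cat phS; apply: prefix_trans IH _.
  by apply: prefix_trans (ph_V _) _; exact: prefix_rcons.
have ph_size s : size s <= size (ph s).
  elim/last_ind: s => // s m IH; rewrite phS !size_rcons ltnS.
  exact: leq_trans IH (size_prefix (ph_V s)).
have ph_a s t : prefix s t -> prefix (ph s) (a (ph t)).
  by move=> /ph_mono st; apply: prefix_trans st (prefix_trans (ph_V _) (V_a _)).
have nth_child s m u : prefix (ph (rcons s m)) u ->
    nth 0 u (size (V (ph s))) = e (ph s) m.
  by rewrite phS => /prefix_rcons_nth.
have a_inj : injective (fun s => a (ph s)).
  (* For comparable nodes, the image of the lower one avoids the child leading to the other;
     otherwise the images differ at index [size (V (ph c))], where [c] is the node at which [s] and
     [t] part. *)
  move=> s t st; apply: contrapT => /seq_trichotomy[[m]|[m]|[c [m [n [mn]]]]].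
  - by move=> /ph_a; rewrite -st => /a_child.
  - by move=> /ph_a; rewrite /= st => /a_child.
  move=> /ph_a/nth_child cm /ph_a/nth_child cn; apply: mn; apply: (e_inj c).
  by rewrite -cm -cn st.
have mem s : a (ph s) \in A by rewrite inE.
exists (fun s => SigSub (mem s) : A) => [s t [st]|E]; first exact: a_inj.
rewrite /irestrict /= (_ : set_val @` _ = (fun s => a (ph s)) @` E); last first.
  by rewrite image_comp.
rewrite !I_wfP; apply: not_iff_compat; split=> -[x Ex].
  have [||y Hy] := @prefix_chain_limit (fun n => ph (mkseq x n)).
  - by move=> n; apply: ph_mono; exact: prefix_mkseq.
  - by move=> n; apply: leq_trans (ph_size _); rewrite size_mkseq.
  exists y => n; have [u Eu xu] := Ex n; exists (a (ph u)); first by exists u.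
  exact: prefix_trans (Hy n) (ph_a _ _ xu).
(* A cluster point [x] of the image is pulled back through nodes [s] lying below elements of [E]
   whose images come arbitrarily close to [x]. *)
pose Q s := forall n, exists u, [/\ E u, prefix s u & prefix (mkseq x n) (a (ph u))].
have Q0 : Q [::].
  by move=> n; have [_ [u Eu <-] xu] := Ex n; exists u; rewrite prefix0s.
have [|y Hy] := branch_exists Q0; last first.
  exists y => n; have [v Qv yv] := Hy n; have [u [Eu vu _]] := Qv 0.
  by exists u => //; exact: prefix_trans vu.
move=> s Qs.
have child n : exists u m, [/\ E u, prefix (rcons s m) u,
    prefix (mkseq x n) (a (ph u)) & e (ph s) m = x (size (V (ph s)))].
  (* Beyond the length of [a (ph s)], [u] cannot be [s] itself; beyond that of [V (ph s)], [x]
     decides through which child of [s] it passes. *)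
  pose N := maxn n (maxn (size (V (ph s))).+1 (size (a (ph s))).+1).
  have [u [Eu su xu]] := Qs N.
  have [r uE] := prefixP su; case: r uE => [|m r] uE.
    have := size_prefix xu; rewrite uE cats0 size_mkseq leqNgt.
    by rewrite !leq_max ltnSn !orbT.
  have smu : prefix (rcons s m) u by rewrite uE -cat_rcons prefix_prefix.
  exists u, m; split=> //.
    by apply: prefix_trans xu; apply: prefix_mkseq; exact: leq_maxl.
  have VN : size (V (ph s)) < N by rewrite !leq_max ltnSn orbT.
  rewrite -(nth_child _ _ _ (ph_a _ _ smu)) (prefix_nth 0 xu) ?size_mkseq//.
  exact: nth_mkseq.
(* By injectivity of [e (ph s)], the child [m] is the same for all [n]. *)
have [_ [m [_ _ _ em]]] := child 0; exists m => n.
have [u [m' [Eu su xu em']]] := child n; exists u; split=> //.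
by rewrite (e_inj s m m')// em em'.
Qed.

Theorem theorem4p5 (A : set (seq nat)) (infA : infinite_set A) :
  (belongs_to_B (irestrict I_wf A) <-> is_borel (irestrict I_wf A)) /\
  (is_borel (irestrict I_wf A) <-> ~ embeds I_wf (irestrict I_wf A)).
Proof.
have i_ii : belongs_to_B (irestrict I_wf A) -> is_borel (irestrict I_wf A).
  by move=> /belongs_to_B_borel bA; apply/is_borelP.
have ii_iii : is_borel (irestrict I_wf A) -> ~ embeds I_wf (irestrict I_wf A).
  move=> /is_borelP bA [f finj fE]; apply: I_wf_not_borel.
  rewrite (_ : I_wf = [set E | irestrict I_wf A (f @` E)]); last first.
    by apply/funext => E; apply/propext; exact: fE.
  (* Each coordinate of the image of [E] under [f] depends on at most one coordinate of [E]. *)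
  apply: borel_family_preimage bA => u.
  have [[s _ <-]|nf] := pselect (range f u); last first.
    rewrite (_ : mkset _ = [set _ | False]); first exact: sigma_cst.
    by apply/seteqP; split=> // E [s _ fs]; apply: nf; exists s.
  rewrite (_ : mkset _ = [set E | E s]); first exact: borel_family_mem.
  by apply/seteqP; split=> E /= => [[t Et /finj <-]|Es] //; exists s.
have iii_i : ~ embeds I_wf (irestrict I_wf A) -> belongs_to_B (irestrict I_wf A).
  move=> noemb; apply: in_B_belongs; apply: good_in_B => //.
  (* [A] is the cone of the root, which is not bad in the absence of an embedding. *)
  rewrite (_ : A = cone A [::]); last first.
    by apply/seteqP; split=> [u Au|u []//]; split=> //; exact: prefix0s.
  by apply: good_not_bad => /bad_embeds.
by split; split=> // ?; [apply: iii_i|apply: i_ii]; tauto.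
Qed.
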